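(* The quantities $$S(u)=\frac{u'''}{u'}-\frac32\left(\frac{u''}{u'}\right)^2\qquad\text{and}\qquad C(u)=(u')^{-1}\left(\frac{u'''}{u'}-\frac{(u'')^2}{(u')^2}\right)$$ are first integrals of the equation $$\frac{u''''}{u'}=-3\frac{(u'')^3}{(u')^3}+4\frac{u'''u''}{(u')^2};$$ that is, for every smooth solution $u$ of this equation on an interval, with $u'$ nowhere zero, both $S(u)$ and $C(u)$ are constant functions of $t$.
   Context: Primes denote derivatives with respect to the independent variable $t\in\mathbb{R}$, and $u$ is a real-valued function of $t$. A first integral of an ODE is a function of the jet of $u$ that is constant along each solution. *)

(* Defs.v *)
From mathcomp Require Import all_boot all_order all_algebra.
From mathcomp Require Import all_classical all_reals all_analysis.
Import numFieldNormedType.Exports.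

Set Implicit Arguments.
Unset Strict Implicit.
Unset Printing Implicit Defensive.

Local Open Scope ring_scope.

(* [j k] is the coordinate u^(k). *)
Definition jet_space (R : realType) := nat -> R.

Definition jet (R : realType) (u : R -> R) (t : R) : jet_space R :=
  fun k => derive1n k u t.

(* [I] may be open, closed, half-open or unbounded.  The derivatives are
   two-sided also at an endpoint belonging to [I]; this loses no generality,
   since a function that is smooth on [I] with one-sided derivatives at the
   endpoints extends to a smooth function on the line. *)
Definition smooth_on (R : realType) (I : interval R) (u : R -> R) : Prop :=
  forall (n : nat) (t : R), t \in I -> derivable (derive1n n u) t 1.

(* An ordinary differential equation is a condition on the jet. *)
Definition smooth_solution (R : realType) (eqn : jet_space R -> Prop)
    (I : interval R) (u : R -> R) : Prop :=
  smooth_on I u /\ (forall t : R, t \in I -> eqn (jet u t)).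

Definition first_integral (R : realType) (eqn : jet_space R -> Prop)
    (F : jet_space R -> R) : Prop :=
  forall (I : interval R) (u : R -> R), smooth_solution eqn I u ->
    forall s t : R, s \in I -> t \in I -> F (jet u s) = F (jet u t).

(* Division by 0 is total, so u' <> 0 is a separate conjunct. *)
Definition equation (R : realType) (j : jet_space R) : Prop :=
  j 1%N != 0 /\
  j 4%N / j 1%N =
    - 3 * (j 2%N ^+ 3 / j 1%N ^+ 3) + 4 * (j 3%N * j 2%N / j 1%N ^+ 2).

Definition S_integral (R : realType) (j : jet_space R) : R :=
  j 3%N / j 1%N - 3 / 2 * (j 2%N / j 1%N) ^+ 2.

Definition C_integral (R : realType) (j : jet_space R) : R :=
  (j 1%N)^-1 * (j 3%N / j 1%N - j 2%N ^+ 2 / j 1%N ^+ 2).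

(* Main.v *)
Require Import Defs.
From mathcomp Require Import all_boot all_order all_algebra.
From mathcomp Require Import all_classical all_reals all_analysis.
From mathcomp Require Import ring.
Import Order.TTheory GRing.Theory Num.Theory numFieldNormedType.Exports.

Local Open Scope ring_scope.

(** Write p = u''/u', q = u'''/u' and E = u''''/u' - 4pq + 3p^3, so that the equation says E = 0.
    Since p' = q - p^2 and q' = u''''/u' - pq, one has S = q - (3/2)p^2 and S' = E, while C = p'/u'
    and C' = E/u'. Both derivatives vanish along a solution ([is_derive_S_integral],
    [is_derive_C_integral]), and a function with zero derivative on an interval is constant there
    ([eq_of_is_derive0_itv]). *)

Lemma eq_of_is_derive0_itv (R : realType) (I : interval R) (f : R -> R) :
  (forall x, x \in I -> is_derive x 1 f 0) -> {in I &, forall s t, f s = f t}.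
Proof.
move=> f0.
have lt_eq s t : s \in I -> t \in I -> s < t -> f s = f t.
  move=> sI tI st.
  have sub x : x \in `[s, t] -> x \in I.
    rewrite in_itv /= => stx; exact: (@interval_is_interval _ I s t) stx.
  have [x _] : exists2 x, x \in `]s, t[%R & f t - f s = 0 * (t - s).
    apply: (@MVT R f (fun=> 0)) => // [x xst|].
      by apply/f0/sub/subset_itv_oo_cc.
    apply: derivable_within_continuous => x xst.
    by case: (f0 x (sub x xst)).
  by rewrite mul0r => /eqP; rewrite subr_eq0 => /eqP.
move=> s t sI tI; case: (ltgtP s t) => [||->//]; first exact: lt_eq.
by move=> ts; apply/esym/lt_eq.
Qed.

Lemma smooth_on_is_derive (R : realType) (I : interval R) (u : R -> R) (n : nat)
    (t : R) : smooth_on I u -> t \in I ->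
  is_derive t 1 (fun x => jet u x n) (jet u t n.+1).
Proof.
move=> su tI; apply: DeriveDef; first exact: su.
by rewrite /jet derive1nS derive1E.
Qed.

Lemma is_derive_div (R : realType) (f g : R -> R) (t df dg : R) :
  g t != 0 -> is_derive t 1 f df -> is_derive t 1 g dg ->
  is_derive t 1 (fun x => f x / g x) ((df * g t - f t * dg) / g t ^+ 2).
Proof.
move=> gt0 fd gd.
have gVd : is_derive t 1 (fun x => (g x)^-1) (- g t ^- 2 *: dg).
  by apply: DeriveDef; [exact: derivableV | rewrite deriveV// derive_val].
apply: is_derive_eq (is_deriveM fd gVd) _.
by rewrite /GRing.scale /=; field.
Qed.

Section TotalDerivative.

(** The curve [j] is only asked to satisfy the contact condition and the equation at the single
    point [t]. Differentiating along it is then a total derivative, computed algebraically in the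
    jet coordinates. *)
Variables (R : realType) (j : R -> jet_space R) (t : R).
Hypothesis dj : forall n, is_derive t 1 (fun x => j x n) (j t n.+1).
Hypothesis eqn_j : equation (j t).

Let j1_neq0 : j t 1%N != 0. Proof. by case: eqn_j. Qed.

(** Eliminating the top coordinate turns both derivative computations into rational identities in
    coordinates 1 to 3, whose denominators are powers of [j t 1]; [field] settles them. *)
Let j4E : j t 4%N = (- 3 * (j t 2%N ^+ 3 / j t 1%N ^+ 3) +
  4 * (j t 3%N * j t 2%N / j t 1%N ^+ 2)) * j t 1%N.
Proof. by case: eqn_j => _ <-; rewrite divfK. Qed.

Let dj21 := is_derive_div _ _ _ _ _ _ j1_neq0 (dj 2%N) (dj 1%N).
Let dj31 := is_derive_div _ _ _ _ _ _ j1_neq0 (dj 3%N) (dj 1%N).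

(** Here S' = q' - 3pp' = E: the equation is exactly the vanishing of S'. *)
Lemma is_derive_S_integral : is_derive t 1 (fun x => S_integral (j x)) 0.
Proof.
have -> : (fun x => S_integral (j x)) = (fun x => j x 3%N / j x 1%N) -
    (3 / 2) \*: (fun x => j x 2%N / j x 1%N) ^+ 2.
  by apply/funext => x; rewrite !fctE.
apply: is_derive_eq (is_deriveB dj31 (is_deriveZ (3 / 2) (is_deriveX 2 dj21))) _.
by rewrite /GRing.scale /= j4E; field.
Qed.

(** From C = p'/u' one gets C' = (p'' - pp')/u', and p'' = q' - 2pp' gives p'' - pp' = q' - 3pp' =
    E. *)
Lemma is_derive_C_integral : is_derive t 1 (fun x => C_integral (j x)) 0.
Proof.
(* Putting C in the form (q - p^2)/u' lets the quotient rule reuse the derivatives of q and p. *)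
have -> : (fun x => C_integral (j x)) = (fun x =>
    ((fun x => j x 3%N / j x 1%N) - (fun x => j x 2%N / j x 1%N) ^+ 2) x /
      j x 1%N).
  by apply/funext => x; rewrite !fctE /C_integral expr_div_n mulrC.
apply: is_derive_eq (is_derive_div _ _ _ _ _ _ j1_neq0
  (is_deriveB dj31 (is_deriveX 2 dj21)) (dj 1%N)) _.
by rewrite !fctE /GRing.scale /= j4E; field.
Qed.

End TotalDerivative.

Theorem proposition2p2 (R : realType) :
  first_integral (@equation R) (@S_integral R) /\
  first_integral (@equation R) (@C_integral R).
Proof.
split=> I u [su eu].
- apply: (@eq_of_is_derive0_itv R I (fun x => S_integral (jet u x))) => t tI.
  apply: is_derive_S_integral; last exact: eu.
  by move=> n; apply: smooth_on_is_derive tI.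
- apply: (@eq_of_is_derive0_itv R I (fun x => C_integral (jet u x))) => t tI.
  apply: is_derive_C_integral; last exact: eu.
  by move=> n; apply: smooth_on_is_derive tI.
Qed.
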